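(* Let $n\ge1$, and let $\mathfrak{gl}(n)_\alpha=\{A_1,\dots,A_d\}$ and $\mathfrak{gl}(n)_\beta=\{E_{i_1j_1},\dots,E_{i_ej_e}\}$ be subsets of the standard basis $\{E_{ij}:1\le i,j\le n\}$ of $\mathfrak{gl}(n)$. Let $\mathcal G_{\rm drift}$ be the directed graph on $\mathrm V=\{1,\dots,n\}$ with an arc $(i,j)$ iff $[A_s]_{ij}\neq0$ for some $s$, and $\mathcal G_{\rm contr}$ the directed graph on $\mathrm V$ with arc set $\{(i_1,j_1),\dots,(i_e,j_e)\}$ (arcs $(i,i)$ are self-loops). If each weakly connected component of $\mathcal G_{\rm contr}$ is strongly connected with at least two nodes, and the union digraph $\mathcal G_{\rm drift}\cup\mathcal G_{\rm contr}$ is strongly connected with at least one self-loop, then the system $\dot X=\mathsf B_0X+(\sum_{i=1}^m u_i\mathsf B_i)X$ is structurally accessible on $\mathrm{GL}^+(n)$ with respect to the pair of zero patterns $\big(\Sigma_{\rm r}(\mathfrak{gl}(n)_\alpha),\Sigma_{\rm f}(\mathfrak{gl}(n)_\beta)\big)$.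
   Context: $E_{ij}$ is the $n\times n$ matrix with $(i,j)$ entry $1$ and others $0$; $\mathrm{GL}^+(n)$ is the identity component of the real general linear group, with Lie algebra $\mathfrak{gl}(n)$. For a finite subset $\{g_s\}$ of a real Lie algebra, $\Sigma_{\rm f}(\{g_s\})=\{\sum l_sg_s:l_s\in\mathbb R\}$, $\Sigma_{\rm r}(\{g_s\})=\{\sum l_sg_s:l_s\in\mathbb R,l_s\ne0\ \forall s\}$. For $\dot X=\mathsf B_0X+(\sum_{i=1}^m u_i\mathsf B_i)X$ on a connected matrix Lie group $\mathbf G$ (piecewise continuous real controls), $\mathcal R(I)$ is the set of states reachable at some time $T\ge0$ from $X(0)=I$; the system is accessible if $\mathcal R(I)$ has an interior point in $\mathbf G$. Structural accessibility w.r.t. $(\Sigma_{\rm r}(\mathfrak g_\alpha),\Sigma_{\rm f}(\mathfrak g_\beta))$: there exist $m\ge1$, $\mathsf B_0\in\Sigma_{\rm r}(\mathfrak g_\alpha)$, $\mathsf B_1,\dots,\mathsf B_m\in\Sigma_{\rm f}(\mathfrak g_\beta)$ making the system accessible. Weakly connected component: component ignoring arc directions; strongly connected: all nodes mutually reachable by directed paths. *)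

(* Defs.v *)
From HB Require Import structures.
From mathcomp Require Import all_boot all_order all_algebra.
From mathcomp Require Import all_classical all_reals all_analysis.
Set Implicit Arguments. Unset Strict Implicit. Unset Printing Implicit Defensive.
Import Order.TTheory GRing.Theory Num.Theory.
Import numFieldNormedType.Exports.
Local Open Scope classical_set_scope.
Local Open Scope ring_scope.

(* Standard basis E_ij of gl(n): delta_mx i j. A subset of the standard basis
   is represented by the set of its index pairs. *)
Definition basis_subset n := {set 'I_n * 'I_n}.

Definition Sigma_f (R : realType) n (S : basis_subset n) : set 'M[R]_n :=
  [set B | exists l : 'I_n * 'I_n -> R,
      B = \sum_(p in S) l p *: delta_mx p.1 p.2].

Definition Sigma_r (R : realType) n (S : basis_subset n) : set 'M[R]_n :=
  [set B | exists l : 'I_n * 'I_n -> R,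
      (forall p, p \in S -> l p != 0) /\
      B = \sum_(p in S) l p *: delta_mx p.1 p.2].

Definition drift_arc (R : realType) n (alpha : basis_subset n) : rel 'I_n :=
  fun i j => [exists p in alpha, (delta_mx p.1 p.2 : 'M[R]_n) i j != 0].
Definition contr_arc n (beta : basis_subset n) : rel 'I_n :=
  fun i j => (i, j) \in beta.
Definition union_rel n (e1 e2 : rel 'I_n) : rel 'I_n := fun i j => e1 i j || e2 i j.
Definition undirected n (e : rel 'I_n) : rel 'I_n := fun i j => e i j || e j i.

Definition wcc_strong_ge2 n (e : rel 'I_n) : Prop :=
  (forall i j, connect (undirected e) i j -> connect e i j) /\
  (forall i, exists j, j != i /\ connect (undirected e) i j).

Definition strongly_connected n (e : rel 'I_n) : Prop :=
  forall i j, connect e i j.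

Definition has_self_loop n (e : rel 'I_n) : Prop := exists i, e i i.

(* Partitions 0 = t_0 < t_1 < ... < t_k = T given as the list [t_1; ...; t_k] *)
Definition partition_of (R : realType) (T : R) (p : seq R) : Prop :=
  path <%R 0 p /\ last 0 p = T.

Definition pieces (R : realType) (p : seq R) : seq (R * R) := zip (0 :: p) p.

(* u is piecewise continuous on [0,T] w.r.t. partition p: on each piece it
   coincides with a function continuous on the closed piece
   (i.e. continuous inside with finite one-sided limits at the ends) *)
Definition pc_on (R : realType) (p : seq R) (u : R -> R) : Prop :=
  forall ab, ab \in pieces p ->
    exists g : R -> R, {within `[ab.1, ab.2], continuous g} /\
      forall t, ab.1 < t < ab.2 -> u t = g t.

Definition trajectory (R : realType) n m (B0 : 'M[R]_n) (B : 'I_m -> 'M[R]_n)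
    (u : 'I_m -> R -> R) (T : R) (X : R -> 'M[R]_n) : Prop :=
  exists p : seq R, partition_of T p /\
    (forall i, pc_on p (u i)) /\
    X 0 = 1%:M /\
    {within `[0, T], continuous X} /\
    (forall ab, ab \in pieces p -> forall t, ab.1 < t < ab.2 ->
        derivable X t 1 /\
        'D_1 X t = (B0 + \sum_(i < m) u i t *: B i) *m X t).

Definition reach_set (R : realType) n m (B0 : 'M[R]_n) (B : 'I_m -> 'M[R]_n)
    : set 'M[R]_n :=
  [set Y | exists (T : R) (u : 'I_m -> R -> R) (X : R -> 'M[R]_n),
      0 <= T /\ trajectory B0 B u T X /\ X T = Y].

Definition GLplus (R : realType) n : set 'M[R]_n := [set M | 0 < \det M].

Definition accessible (R : realType) n m (B0 : 'M[R]_n) (B : 'I_m -> 'M[R]_n)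
    : Prop :=
  exists (Y : 'M[R]_n) (U : set 'M[R]_n),
    open U /\ U Y /\ @GLplus R n Y /\ U `&` @GLplus R n `<=` reach_set B0 B.

Definition struct_accessible (R : realType) n (alpha beta : basis_subset n)
    : Prop :=
  exists (m : nat) (B0 : 'M[R]_n) (B : 'I_m -> 'M[R]_n),
    (1 <= m)%N /\ Sigma_r alpha B0 /\ (forall i, Sigma_f beta (B i)) /\
    accessible B0 B.

(* Main.v *)
(** The controls generate every off-diagonal [E_ij] inside a weak component, and
    the self-loop together with the strong connectivity of the union graph forces
    every Lie subalgebra containing the controls and a suitable drift [B0] to be
    all of [gl(n)].

    Accessibility follows by an argument of Krener type.  For a product of
    exponentials [e^(t_k C_k) ... e^(t_1 C_1)] of admissible directions with
    positive times, let [W] be the span of the right-translated partial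
    derivatives in the [t_i], and choose the product so that [dim W] is maximal.
    Prolonging the product then only transports [W] by [Ad], so [W] contains the
    subspace [K] of all [M] whose transports [Ad (g^-1) M] stay in [W] for every
    product [g].  [K] contains the admissible directions and, differentiating at
    time [0], is stable under bracketing with them; hence [K], and so [W], is
    [gl(n)].  The product is thus a submersion in the switching times, and a
    contraction argument shows that it covers a ball. *)

Require Import Defs.
From HB Require Import structures.
From mathcomp Require Import all_boot all_order all_algebra.
From mathcomp Require Import all_classical all_reals all_analysis.
From mathcomp Require Import ring lra.
Set Implicit Arguments. Unset Strict Implicit. Unset Printing Implicit Defensive.
Import Order.TTheory GRing.Theory Num.Theory.
Import numFieldNormedType.Exports.
Local Open Scope classical_set_scope.
Local Open Scope ring_scope.

(** * Lie subalgebras of matrices *)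

Definition mxbracket (R : pzRingType) n (A B : 'M[R]_n) : 'M[R]_n :=
  A *m B - B *m A.

Definition submodule (R : pzRingType) n (S : 'M[R]_n -> Prop) : Prop :=
  [/\ S 0, (forall A B, S A -> S B -> S (A + B)) &
      (forall a A, S A -> S (a *: A))].

Definition lie_subalgebra (R : pzRingType) n (S : 'M[R]_n -> Prop) : Prop :=
  submodule S /\ (forall A B, S A -> S B -> S (mxbracket A B)).

Lemma delta_mxE (R : pzRingType) n (i j k l : 'I_n) :
  (delta_mx i j : 'M[R]_n) k l = ((k == i) && (l == j))%:R.
Proof. by rewrite mxE. Qed.

Lemma sandwich_delta_mx (R : pzRingType) n (M : 'M[R]_n) (p p' q q' : 'I_n) :
  delta_mx p' p *m M *m delta_mx q q' = M p q *: delta_mx p' q'.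
Proof.
apply/matrixP => i j; rewrite !mxE (bigD1 q) //= big1 ?addr0; last first.
  by move=> k kq; rewrite !mxE (negbTE kq) /= mulr0.
rewrite !mxE eqxx /= (bigD1 p) //= big1 ?addr0; last first.
  by move=> k kp; rewrite !mxE (negbTE kp) andbF mul0r.
rewrite !mxE eqxx andbT.
by case: (i == p'); case: (j == q'); rewrite /= ?mul1r ?mulr1 ?mul0r ?mulr0.
Qed.

Lemma mxbracket_delta (R : pzRingType) n (i j k l : 'I_n) :
  mxbracket (delta_mx i j) (delta_mx k l) =
  (j == k)%:R *: delta_mx i l - (l == i)%:R *: delta_mx k j :> 'M[R]_n.
Proof.
rewrite /mxbracket !mul_delta_mx_cond.
by case: (j == k); case: (l == i); rewrite ?scale1r ?scale0r.
Qed.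

Lemma mxbracket_diagE (R : comPzRingType) n (d : 'rV[R]_n) (M : 'M[R]_n) i j :
  mxbracket (diag_mx d) M i j = (d 0 i - d 0 j) * M i j.
Proof. by rewrite /mxbracket mul_diag_mx mul_mx_diag !mxE; ring. Qed.

Lemma mxbracketDl (R : pzRingType) n (X Y M : 'M[R]_n) :
  mxbracket (X + Y) M = mxbracket X M + mxbracket Y M.
Proof. by rewrite /mxbracket mulmxDl mulmxDr opprD addrACA. Qed.

Lemma mxbracketDr (R : pzRingType) n (M X Y : 'M[R]_n) :
  mxbracket M (X + Y) = mxbracket M X + mxbracket M Y.
Proof. by rewrite /mxbracket mulmxDl mulmxDr opprD addrACA. Qed.

Lemma mxbracketZl (R : comPzRingType) n a (X M : 'M[R]_n) :
  mxbracket (a *: X) M = a *: mxbracket X M.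
Proof. by rewrite /mxbracket -scalemxAl -scalemxAr scalerBr. Qed.

Lemma mxbracket_jacobi (R : comPzRingType) n (X Y M : 'M[R]_n) :
  mxbracket (mxbracket X Y) M =
  mxbracket X (mxbracket Y M) - mxbracket Y (mxbracket X M).
Proof.
rewrite /mxbracket !(mulmxBl, mulmxBr) !mulmxA.
by apply/matrixP => i j; rewrite !mxE; ring.
Qed.

Section LieSubalgebra.
Variables (R : realFieldType) (n : nat) (S : 'M[R]_n -> Prop).
Hypothesis Slie : lie_subalgebra S.

Lemma lieD A B : S A -> S B -> S (A + B).
Proof. by case: Slie => [[_ h _] _]; apply: h. Qed.
Lemma lieZ a A : S A -> S (a *: A).
Proof. by case: Slie => [[_ _ h] _]; apply: h. Qed.
Lemma lieB A B : S A -> S B -> S (A - B).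
Proof. by move=> sA sB; apply: lieD => //; rewrite -scaleN1r; apply: lieZ. Qed.
Lemma lie_bracket A B : S A -> S B -> S (mxbracket A B).
Proof. by case: Slie => _; apply. Qed.
Lemma lie_sum (I : Type) (s : seq I) (P : pred I) (F : I -> 'M[R]_n) :
  (forall i, P i -> S (F i)) -> S (\sum_(i <- s | P i) F i).
Proof.
by move=> h; elim/big_ind: _ => //; [case: Slie => [[]] | exact: lieD].
Qed.
Lemma lieZK a A : a != 0 -> S (a *: A) -> S A.
Proof. by move=> a0 /(lieZ a^-1); rewrite scalerA mulVf // scale1r. Qed.

Lemma lie_delta_trans i j k : i != k ->
  S (delta_mx i j) -> S (delta_mx j k) -> S (delta_mx i k).
Proof.
move=> ik sij sjk; have := lie_bracket sij sjk.
by rewrite mxbracket_delta eqxx eq_sym (negbTE ik) scale1r scale0r subr0.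
Qed.

(** [X] and [Y] are eigenvectors of [ad D] for distinct eigenvalues, so [ad D - b] kills [Y] and
    multiplies [X] by [a - b]. *)
Lemma lie_separate D X Y (a b : R) : a != b -> S D -> S (X + Y) ->
  mxbracket D X = a *: X -> mxbracket D Y = b *: Y -> S X.
Proof.
move=> ab sD sXY DX DY; apply: (@lieZK (a - b)); first by rewrite subr_eq0.
have := lieB (lie_bracket sD sXY) (lieZ b sXY).
suff -> : mxbracket D (X + Y) - b *: (X + Y) = (a - b) *: X by [].
by rewrite mxbracketDr DX DY scalerBl scalerDr opprD addrACA subrr addr0.
Qed.

(** * Entries within and across the classes of an equivalence [sim] *)

Variables (sim : rel 'I_n).
Hypotheses (sim_sym : symmetric sim) (sim_trans : transitive sim).
Hypothesis sim_partner : forall i, exists2 j : 'I_n, j != i & sim i j.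
Hypothesis Ssim : forall i j, i != j -> sim i j -> S (delta_mx i j).

Lemma sim_chain i j k : sim i j -> sim j k -> sim i k.
Proof. exact: sim_trans. Qed.

Lemma sim_refl i : sim i i.
Proof. have [j _ ij] := sim_partner i; apply: (sim_chain ij); by rewrite sim_sym. Qed.

Lemma lie_sim_diff i j : sim i j -> S (delta_mx i i - delta_mx j j).
Proof.
move=> ij; have [->|inj] := eqVneq i j.
  by rewrite subrr; case: Slie => [[]].
have := lie_bracket (Ssim inj ij).
move/(_ (delta_mx j i)); rewrite mxbracket_delta !eqxx !scale1r; apply.
by apply: Ssim; rewrite 1?eq_sym 1?sim_sym.
Qed.

(* [1 - ad_h ^ 2] with [h = E_pp - E_p'p'] kills every entry having exactly one
   index in [{p, p'}] and fixes the diagonal. *)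
Lemma lie_kill_cross M (s : seq 'I_n) : S M ->
  exists M', [/\ S M', forall i, M' i i = M i i &
    forall i j, ~~ sim i j -> (i \in s) -> M' i j = 0].
Proof.
move=> sM; elim: s => [|p s [M' [sM' dM' zM']]]; first by exists M; split.
have [p' pp' spp'] := sim_partner p.
pose h : 'rV[R]_n := \row_i ((i == p)%:R - (i == p')%:R).
have sh : S (diag_mx h).
  suff -> : diag_mx h = delta_mx p p - delta_mx p' p' by exact: lie_sim_diff.
  apply/matrixP => i j; rewrite !mxE; have [->|ij] := eqVneq i j.
    by rewrite mulr1n !andbb.
  rewrite mulr0n -!mulnb !natrM.
  have jF k : i = k -> (j == k) = false by move=> <-; rewrite eq_sym (negbTE ij).
  have [ip | ip] := eqVneq i p.
    by rewrite (jF _ ip) ip (eq_sym p) (negbTE pp') mulr0 mul0r subrr.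
  have [ip' | ip'] := eqVneq i p'; last by rewrite !mul0r subrr.
  by rewrite (jF _ ip') mul0r mulr0 subrr.
have ppF : (p == p') = false by rewrite eq_sym (negbTE pp').
exists (M' - mxbracket (diag_mx h) (mxbracket (diag_mx h) M')).
have E i j : (M' - mxbracket (diag_mx h) (mxbracket (diag_mx h) M')) i j =
    (1 - (h 0 i - h 0 j) ^+ 2) * M' i j.
  by rewrite mxE [X in _ + X]mxE !mxbracket_diagE; ring.
split=> [|i|i j sij]; first by apply: lieB => //; do 2!apply: lie_bracket => //.
  by rewrite E subrr expr0n /= subr0 mul1r.
rewrite E inE => /orP[/eqP ip|js]; last by rewrite zM' ?mulr0.
rewrite {}ip in sij *; have jp : j != p by apply: contraNneq sij => ->; exact: sim_refl.
have jp' : j != p' by apply: contraNneq sij => ->.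
by rewrite !mxE eqxx ppF (negbTE jp) (negbTE jp') /=; ring.
Qed.

(** Once [lie_kill_cross] has treated every index, only the diagonal and same-class entries survive,
    and the off-diagonal ones among them are multiples of units already in [S]. *)
Lemma lie_diag M : S M -> S (diag_mx (\row_i M i i)).
Proof.
move=> sM; have [M' [sM' dM' zM']] := lie_kill_cross (enum 'I_n) sM.
suff -> : diag_mx (\row_i M i i) = M' -
    \sum_(i < n) \sum_(j < n | (i != j) && sim i j) M' i j *: delta_mx i j.
  apply: lieB => //; apply: lie_sum => i _; apply: lie_sum => j /andP[ij sij].
  by apply: lieZ; exact: Ssim.
apply/matrixP => i j; rewrite mxE [in RHS]mxE [X in _ + X]mxE summxE.
rewrite [X in _ - X](bigD1 i) //= [X in _ - (_ + X)]big1 ?addr0; last first.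
  move=> k ki; rewrite summxE big1 // => l _; rewrite !mxE eq_sym.
  by rewrite (negbTE ki) /= mulr0.
rewrite summxE !mxE; have [<-|ij] := eqVneq i j.
  rewrite mulr1n big1 ?subr0 // => k /andP[ik _].
  by rewrite !mxE (negbTE ik) andbF mulr0.
rewrite mulr0n; have [sij|sij] := boolP (sim i j).
  rewrite (bigD1 j) ?ij //= !mxE !eqxx mulr1 big1 ?addr0 ?subrr // => k /andP[_ kj].
  by rewrite !mxE eq_sym (negbTE kj) andbF mulr0.
rewrite zM' ?mem_enum // big1 ?subr0 // => k /andP[_ sik].
rewrite !mxE; have [jk|] := eqVneq j k; last by rewrite andbF mulr0.
by rewrite jk sik in sij.
Qed.

(* When both classes have two elements the two units cannot be separated by the
   same-class units alone: [sl_2] is self-dual. *)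
Lemma lie_cross M p p' q q' : S M -> ~~ sim p q -> sim p p' -> sim q q' ->
  p != p' -> q != q' ->
  S (M p q *: delta_mx p' q' + M q' p' *: delta_mx q p).
Proof.
move=> sM pq pp' qq' npp' nqq'.
have sp : S (delta_mx p' p) by apply: Ssim; rewrite 1?eq_sym 1?sim_sym.
have := lie_bracket sp (lie_bracket sM (Ssim nqq' qq')).
suff -> : mxbracket (delta_mx p' p) (mxbracket M (delta_mx q q')) =
  M p q *: delta_mx p' q' + M q' p' *: delta_mx q p by [].
(* Two of the four products in the double bracket vanish: [p = q] or [p' = q'] would put [p] and [q]
   in one class. *)
have n1 : (p == q) = false by apply: contraNF pq => /eqP ->; exact: sim_refl.
have n2 : (q' == p') = false.
  apply: contraNF pq => /eqP qp; apply: (sim_chain pp').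
  by rewrite -qp sim_sym.
rewrite /mxbracket mulmxBr mulmxBl !mulmxA !sandwich_delta_mx.
rewrite mul_delta_mx_cond n1 mulr0n mul0mx subr0.
rewrite -(mulmxA M) mul_delta_mx_cond n2 mulr0n mulmx0 sub0r.
by rewrite opprK.
Qed.

(** * Matrix units in the row of a root vertex [r] *)

Variables (B0 : 'M[R]_n) (r : 'I_n) (d : 'rV[R]_n).
Hypotheses (SB0 : S B0) (Sd : S (diag_mx d)).
(** The gap makes a sum of two entries of [d] exceed [2] as soon as one of them sits at [r], and at
    most [2] otherwise. *)
Hypotheses (dr : 3 <= d 0 r) (d01 : forall i, i != r -> 0 <= d 0 i <= 1).
Hypothesis B0_conn : forall j, connect [rel i j | sim i j || (B0 i j != 0)] r j.

Lemma diag_bracket_delta i j (c : R) :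
  mxbracket (diag_mx d) (c *: delta_mx i j) =
  (d 0 i - d 0 j) *: (c *: delta_mx i j).
Proof.
apply/matrixP => k l; rewrite mxbracket_diagE !mxE.
have [->|] := eqVneq k i; have [->|] := eqVneq l j => //=; by rewrite !mulr0.
Qed.

(** Units propagate along a path from [r]: a same-class step is a bracket of two units, while a
    drift arc between classes goes through [lie_cross]. *)
Lemma lie_root_row j : j != r -> S (delta_mx r j).
Proof.
have sr i : sim r i -> i != r -> S (delta_mx r i).
  by move=> ri ir; apply: Ssim; rewrite // eq_sym.
have tr i k : S (delta_mx r i) -> sim i k -> k != r -> S (delta_mx r k).
  move=> ri sik kr; have [<-//|ik] := eqVneq i k.
  by apply: lie_delta_trans ri _; [rewrite eq_sym|exact: Ssim].
have /connectP[p + ->] := B0_conn j.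
elim/last_ind: p => [|p k IH]; first by rewrite eqxx.
rewrite rcons_path last_rcons; set i := last r p in IH *.
move=> /andP[/IH{}IH /= ik] kr.
have [rk|rk] := boolP (sim r k); first exact: sr.
have [sik|sik] := boolP (sim i k).
  have [ir|/IH ri] := eqVneq i r; first by rewrite ir (negbTE rk) in sik.
  exact: tr ri sik kr.
move: ik; rewrite (negbTE sik) /= => Bik.
have [k' k'k kk'] := sim_partner k.
have kn : k != k' by rewrite eq_sym.
have k'r : k' != r.
  by apply: contraNneq rk => <-; rewrite sim_sym.
(* It is enough to reach the partner [k'], since one more same-class step leads to [k]. *)
suff : S (delta_mx r k') by move=> /tr; apply; rewrite // sim_sym.
have [ri|ri] := boolP (sim r i).
  (* One of [i], [i'] is taken to be [r]. The two units of [lie_cross] have [ad d] eigenvalues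
     [d_i' - d_k'] and [d_k - d_i], which differ because [d_i + d_i' > 2 >= d_k + d_k']. *)
  have [i' [i'i ii' dii']] :
      exists i' : 'I_n, [/\ i' != i, sim i i' & 2 < d 0 i + d 0 i'].
    have [->|ir] := eqVneq i r.
      have [i' i'r ri'] := sim_partner r; exists i'; split=> //.
      by move: dr (d01 i'r) => + /andP[]; lra.
    exists r; split; rewrite 1?eq_sym 1?sim_sym //.
    by move: dr (d01 ir) => + /andP[]; lra.
  have nii' : i != i' by rewrite eq_sym.
  have : S (B0 i k *: delta_mx i' k').
    apply: (lie_separate _ Sd (lie_cross SB0 sik ii' kk' nii' kn)); last first.
    - exact: diag_bracket_delta.
    - exact: diag_bracket_delta.
    apply/eqP; move: dii' (d01 kr) (d01 k'r) => + /andP[+ +] /andP[]; lra.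
  move=> /lieZK -/(_ Bik) si'k'.
  have [<-//|i'r] := eqVneq i' r.
  apply: lie_delta_trans si'k'; first by rewrite eq_sym.
  by apply: sr => //; apply: (sim_chain ri).
(* Away from the class of [r] a bracket with [E_ri'] separates the units: it turns [E_i'k'] into
   [E_rk'] and kills [E_ki], as [i' != k] and [i != r]. *)
have ir : i != r by apply: contraNneq ri => ->; exact: sim_refl.
have [i' i'i ii'] := sim_partner i.
have nii' : i != i' by rewrite eq_sym.
have i'r : i' != r by apply: contraNneq ri => <-; rewrite sim_sym.
have ri' : S (delta_mx r i') by apply: tr (IH ir) ii' i'r.
have := lie_bracket ri' (lie_cross SB0 sik ii' kk' nii' kn).
have i'k : (i' == k) = false by apply: contraNF sik => /eqP <-.
rewrite /mxbracket mulmxDr mulmxDl -!scalemxAr -!scalemxAl !mul_delta_mx_cond.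
rewrite eqxx i'k (negbTE k'r) (negbTE ir) !mulr0n !scaler0 !addr0 subr0 mulr1n.
exact: lieZK.
Qed.
End LieSubalgebra.

(** * From the row and column of the root to all of [gl(n)] *)

Section LieFull.
Variables (R : realFieldType) (n : nat) (S : 'M[R]_n -> Prop).
Hypothesis Slie : lie_subalgebra S.
Variables (sim : rel 'I_n).
Hypotheses (sim_sym : symmetric sim) (sim_trans : transitive sim).
Hypothesis sim_partner : forall i, exists2 j : 'I_n, j != i & sim i j.
Hypothesis Ssim : forall i j, i != j -> sim i j -> S (delta_mx i j).
Variables (B0 : 'M[R]_n) (r : 'I_n) (d : 'rV[R]_n).
Hypotheses (SB0 : S B0) (Sd : S (diag_mx d)).
Hypotheses (dr : 3 <= d 0 r) (d01 : forall i, i != r -> 0 <= d 0 i <= 1).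
Hypothesis B0_conn : forall i j, connect [rel i j | sim i j || (B0 i j != 0)] i j.

(** This is the row case for the transposed subalgebra: transposition reverses brackets and arcs and
    fixes diagonal matrices. *)
Lemma lie_root_col j : j != r -> S (delta_mx j r).
Proof.
pose S' M := S (M^T).
have S'lie : lie_subalgebra S'.
  split; first split.
  - by rewrite /S' trmx0; case: Slie => [[]].
  - by move=> A B sA sB; rewrite /S' linearD; exact: lieD.
  - by move=> a A sA; rewrite /S' linearZ; exact: lieZ.
  - move=> A B sA sB; have := lie_bracket Slie sB sA.
    by rewrite /S' /mxbracket linearB /= !trmx_mul.
have S'sim i k : i != k -> sim i k -> S' (delta_mx i k).
  move=> ik sik; rewrite /S' trmx_delta; apply: Ssim; first by rewrite eq_sym.
  by rewrite sim_sym.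
have S'B0 : S' B0^T by rewrite /S' trmxK.
have S'd : S' (diag_mx d) by rewrite /S' tr_diag_mx.
have conn' k : connect [rel i j | sim i j || (B0^T i j != 0)] r k.
  pose e := [rel i j | sim i j || (B0 i j != 0)].
  have : connect [rel x y | e y x] r k by rewrite connect_rev; exact: B0_conn.
  apply: connect_sub => i l /=.
  by move=> h; apply: connect1; rewrite /= mxE sim_sym.
move=> jr; have := lie_root_row S'lie sim_sym sim_trans sim_partner S'sim
  S'B0 S'd dr d01 conn' jr.
by rewrite /S' trmx_delta.
Qed.

Lemma lie_full M : S M.
Proof.
have row := lie_root_row Slie sim_sym sim_trans sim_partner Ssim SB0 Sd dr d01
  (B0_conn r).
have sdelta i j : i != j -> S (delta_mx i j).
  move=> ij; have [ir|ir] := eqVneq i r.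
    by rewrite ir; apply: row; rewrite -ir eq_sym.
  have [->|jr] := eqVneq j r; first exact: lie_root_col.
  by apply: (lie_delta_trans Slie ij (lie_root_col ir)); exact: row.
have sdiff i : S (delta_mx i i - delta_mx r r).
  have [->|ir] := eqVneq i r; first by rewrite subrr; case: Slie => [[]].
  have := lie_bracket Slie (sdelta _ _ ir) (sdelta r i _).
  by rewrite mxbracket_delta !eqxx !scale1r eq_sym; exact.
(* The elements found so far have trace zero. [diag_mx d] has trace at least [3], and removing its
   traceless part leaves a nonzero multiple of [E_rr]. *)
have srr : S (delta_mx r r).
  apply: (lieZK Slie (a := \sum_i d 0 i)).
    apply: lt0r_neq0; rewrite (bigD1 r) //=.
    apply: (@lt_le_trans _ _ (3 + 0)); first by lra.
    by apply: lerD => //; apply: sumr_ge0 => i /d01/andP[].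
  suff -> : (\sum_i d 0 i) *: delta_mx r r =
     diag_mx d - \sum_i d 0 i *: (delta_mx i i - delta_mx r r) :> 'M[R]_n.
    by apply: lieB => //; apply: lie_sum => // i _; exact: lieZ.
  rewrite diag_mx_sum_delta scaler_suml -sumrB; apply: eq_bigr => i _.
  by rewrite scalerBr subKr.
rewrite [M]matrix_sum_delta; apply: lie_sum => // i _; apply: lie_sum => // j _.
apply: lieZ => //; have [->|/sdelta//] := eqVneq i j.
by rewrite -[delta_mx _ _](subrK (delta_mx r r)); exact: lieD.
Qed.
End LieFull.

(** * The matrix exponential *)

Section ExpBoundedSeries.
Variable R : realType.

(** Domination by the series of [K * exp (M x)]. The bound survives formal differentiation, with
    [K * M] for [K], so such series converge everywhere and may be differentiated term by term. *)
Definition exp_bounded (c : nat -> R) : Prop :=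
  exists K M : R, [/\ 0 <= K, 0 <= M &
    forall k, `|c k| <= K * (M ^+ k / k`!%:R)].

Lemma exp_bounded_cvg c x : exp_bounded c -> cvgn (pseries c x).
Proof.
move=> [K [M [K0 M0 bc]]]; apply: normed_cvg; rewrite /normed_series_of /=.
apply: (@series_le_cvg _ _ (fun k => K * exp_coeff (M * `|x|) k)) => [k|k|k|].
- by [].
- by rewrite mulr_ge0 // exp_coeff_ge0 // mulr_ge0.
- rewrite normrM normrX /exp_coeff /= exprMn.
  by rewrite mulrAC mulrA; apply: ler_wpM2r; rewrite ?exprn_ge0.
- rewrite (_ : (fun k => _) = K *: exp_coeff (M * `|x|)) //.
  exact/is_cvg_seriesZ/is_cvg_series_exp_coeff.
Qed.

Lemma exp_bounded_diffs c : exp_bounded c -> exp_bounded (pseries_diffs c).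
Proof.
move=> [K [M [K0 M0 bc]]]; exists (K * M), M; split=> [||k] //.
  exact: mulr_ge0.
rewrite /pseries_diffs normrM ger0_norm //.
apply: (le_trans (ler_wpM2l _ (bc k.+1))) => //.
rewrite factS natrM exprS.
have k0 : (k.+1%:R : R) != 0 by rewrite pnatr_eq0.
have f0 : (k`!%:R : R) != 0 by rewrite pnatr_eq0 -lt0n fact_gt0.
by rewrite le_eqVlt; apply/orP; left; apply/eqP; field; rewrite f0 addrC natr1 k0.
Qed.

Lemma exp_bounded_is_derive c x : exp_bounded c ->
  is_derive x (1 : R) (fun x => limn (pseries c x))
    (limn (pseries (pseries_diffs c) x)).
Proof.
move=> bc; apply: (@pseries_snd_diffs _ _ (`|x| + 1)).
- exact: exp_bounded_cvg.
- by apply: exp_bounded_cvg; exact: exp_bounded_diffs.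
- by apply: exp_bounded_cvg; do 2!apply: exp_bounded_diffs.
- by rewrite [ltRHS]ger0_norm ?addr_ge0 // ltrDl.
Qed.

Lemma lim_pseries_lin (I : finType) (a : I -> R) (c : I -> nat -> R) x :
  (forall i, exp_bounded (c i)) ->
  limn (pseries (fun k => \sum_i a i * c i k) x) =
  \sum_i a i * limn (pseries (c i) x).
Proof.
move=> bc; apply: cvg_lim => //.
rewrite (_ : pseries _ x = fun m => \sum_i a i * pseries (c i) x m).
  apply: cvg_big => [|i _]; [exact: add_continuous|apply: cvgMl_tmp].
  exact: exp_bounded_cvg.
apply/funext => m; rewrite /pseries /series /=.
under eq_bigr do rewrite mulr_suml.
rewrite exchange_big /=; apply: eq_bigr => i _; rewrite mulr_sumr.
by apply: eq_bigr => k _; rewrite mulrA.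
Qed.
End ExpBoundedSeries.

(** Entrywise, so that the rules for real functions apply; [is_derive_mx_derive] returns to the
    ['D_1] of [trajectory]. *)
Definition is_derive_mx (R : realType) n (X : R -> 'M[R]_n) (t : R)
  (D : 'M[R]_n) : Prop :=
  forall i j, is_derive t (1 : R) (fun s => X s i j) (D i j).

Section MatrixDerivative.
Variables (R : realType) (n : nat).
Implicit Types (X Y : R -> 'M[R]_n) (t : R) (C D : 'M[R]_n).

Lemma is_derive_mx_cst C t : is_derive_mx (fun=> C) t 0.
Proof. by move=> i j; rewrite mxE; exact: is_derive_cst. Qed.

Lemma is_derive_mxM X Y t DX DY : is_derive_mx X t DX -> is_derive_mx Y t DY ->
  is_derive_mx (fun s => X s *m Y s) t (DX *m Y t + X t *m DY).
Proof.
move=> dX dY i j.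
rewrite (_ : (fun s => _) = \sum_k ((fun s => X s i k) * (fun s => Y s k j))).
  apply: (is_derive_eq (is_derive_sum (fun k => is_deriveM (dX i k) (dY k j)))).
  rewrite !mxE -big_split /=.
  apply: eq_bigr => k _; rewrite addrC; congr (_ + _).
  by rewrite /GRing.scale /= mulrC.
by apply/funext => s; rewrite mxE fct_sumE.
Qed.

Lemma is_derive_mx_comp X (f : R -> R) t a D : is_derive t (1:R) f a ->
  is_derive_mx X (f t) D -> is_derive_mx (fun s => X (f s)) t (a *: D).
Proof.
move=> df dX i j; have := @is_derive1_comp R (fun s => X s i j) f t _ _ (dX i j) df.
by rewrite mxE mulrC.
Qed.

Lemma is_derive_mx_derive X t D : is_derive_mx X t D ->
  derivable X t 1 /\ 'D_1 X t = D.
Proof.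
move=> dX; have h : derivable X t 1.
  by apply/derivable_mxP => i j; case: (dX i j).
split=> //; rewrite derive_mx //; apply/matrixP => i j; rewrite mxE.
by case: (dX i j).
Qed.

Lemma is_derive_mx_0_cst X s t : (forall x, is_derive_mx X x 0) -> X s = X t.
Proof.
move=> dX; apply/matrixP => i j.
by apply: (@is_derive_0_is_cst _ (fun s => X s i j)) => x; have := dX x i j; rewrite mxE.
Qed.
End MatrixDerivative.

Section MatrixExponential.
Variables (R : realType) (n : nat).
Implicit Types (C : 'M[R]_n) (t : R).

Definition mxpow C k : 'M[R]_n := iter k (mulmx C) 1%:M.

Definition expm C t : 'M[R]_n :=
  \matrix_(i, j) limn (pseries (fun k => mxpow C k i j / k`!%:R) t).

Lemma mxpow_bounded C i j : exp_bounded (fun k => mxpow C k i j / k`!%:R).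
Proof.
pose M : R := \sum_i \sum_j `|C i j|.
(* [M], the sum of all moduli, dominates every row sum, whence entries of the [k]-th power are at
   most [M ^+ k]. *)
have M0 : 0 <= M by do 2!apply: sumr_ge0 => ? _.
exists 1, M; split=> // k; rewrite mul1r normrM normfV normr_nat.
apply: ler_wpM2r; first by rewrite invr_ge0.
elim: k i j => [|k IH] i j; first by rewrite expr0 mxE normr_nat lern1 leq_b1.
rewrite /mxpow iterS mxE; apply: (le_trans (ler_norm_sum _ _ _)).
have Mi : \sum_l `|C i l| <= M.
  by rewrite /M [leRHS](bigD1 i) //= lerDl; do 2!apply: sumr_ge0 => ? _.
rewrite exprS; apply: (@le_trans _ _ (\sum_l `|C i l| * M ^+ k)).
  by apply: ler_sum => l _; rewrite normrM ler_wpM2l //; exact: IH.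
by rewrite -mulr_suml ler_wpM2r // exprn_ge0.
Qed.

Lemma is_derive_expm C t : is_derive_mx (expm C) t (C *m expm C t).
Proof.
move=> i j; rewrite (_ : (fun s => _) =
  (fun s => limn (pseries (fun k => mxpow C k i j / k`!%:R) s))); last first.
  by apply/funext => s; rewrite mxE.
rewrite (_ : (C *m _) i j =
  limn (pseries (pseries_diffs (fun k => mxpow C k i j / k`!%:R)) t)).
  exact/exp_bounded_is_derive/mxpow_bounded.
rewrite (_ : pseries_diffs _ =
  fun k => \sum_l C i l * (mxpow C k l j / k`!%:R)).
  rewrite lim_pseries_lin; last by move=> l; exact: mxpow_bounded.
  by rewrite mxE; apply: eq_bigr => l _; rewrite mxE.
apply/funext => k; rewrite /pseries_diffs factS natrM invfM.
rewrite mulrCA [k.+1%:R * _]mulrA mulfV ?pnatr_eq0 // mul1r /mxpow iterS mxE mulr_suml.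
by apply: eq_bigr => l _; rewrite mulrA.
Qed.

Lemma expm0 C : expm C 0 = 1%:M.
Proof.
apply/matrixP => i j; rewrite mxE; apply: cvg_lim => //.
rewrite -(cvg_shiftn 1) /=.
rewrite (_ : (fun m => _) = cst ((1%:M : 'M[R]_n) i j)); first exact: cvg_cst.
apply/funext => m; rewrite addn1 /pseries /series /= big_nat_recl //= big1 ?addr0.
  by rewrite expr0 mulr1 fact0 invr1 mulr1.
by move=> k _; rewrite exprS mul0r mulr0.
Qed.

Lemma mxpow_comm C k : mxpow C k *m C = C *m mxpow C k.
Proof.
elim: k => [|k IH]; first by rewrite /mxpow /= mul1mx mulmx1.
by rewrite /mxpow iterS -mulmxA -/(mxpow C k) IH.
Qed.

Lemma expm_comm C t : expm C t *m C = C *m expm C t.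
Proof.
apply/matrixP => i j; rewrite [LHS]mxE [RHS]mxE.
under eq_bigr do rewrite mxE mulrC.
under [RHS]eq_bigr do rewrite mxE.
rewrite -!lim_pseries_lin; try by move=> l; exact: mxpow_bounded.
congr (limn (pseries _ t)); apply/funext => k.
have := mxpow_comm C k => /matrixP/(_ i j).
rewrite !mxE => /(congr1 (fun z => z / k`!%:R)).
rewrite !mulr_suml => E; transitivity (\sum_l mxpow C k i l * C l j / k`!%:R).
  by apply: eq_bigr => l _; ring.
by rewrite E; apply: eq_bigr => l _; ring.
Qed.

Lemma is_derive_expmN C t :
  is_derive_mx (fun s => expm C (- s)) t (- (expm C (- t) *m C)).
Proof.
rewrite expm_comm -scaleN1r; apply: is_derive_mx_comp; last exact: is_derive_expm.
Qed.

(** The product [e^(-tC) X(t)] has zero derivative. Inverses and the addition formula follow by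
    choosing particular solutions [X]. *)
Lemma expm_ode_unique C (X : R -> 'M[R]_n) t :
  (forall s, is_derive_mx X s (C *m X s)) -> expm C (- t) *m X t = X 0.
Proof.
move=> dX; transitivity (expm C (- 0) *m X 0); last by rewrite oppr0 expm0 mul1mx.
apply: (@is_derive_mx_0_cst _ _ (fun t => expm C (- t) *m X t)) => s.
have := is_derive_mxM (is_derive_expmN C s) (dX s).
by rewrite mulNmx mulmxA addrC subrr.
Qed.

Lemma expmNK C t : expm C (- t) *m expm C t = 1%:M.
Proof. by rewrite (expm_ode_unique _ (is_derive_expm C)) expm0. Qed.

Lemma expmKN C t : expm C t *m expm C (- t) = 1%:M.
Proof. by have := expmNK C (- t); rewrite opprK. Qed.

Lemma expmD C s t : expm C (s + t) = expm C s *m expm C t.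
Proof.
have dX x : is_derive_mx (fun s => expm C (s + t)) x (C *m expm C (x + t)).
  rewrite -[X in is_derive_mx _ _ X]scale1r.
  apply: is_derive_mx_comp (is_derive_expm C _).
  exact: is_derive_shift.
have := expm_ode_unique s dX; rewrite add0r => <-.
by rewrite mulmxA expmKN mul1mx.
Qed.

(** [e^(tC)] is the square of the invertible matrix [e^(tC/2)]. *)
Lemma det_expm_gt0 C t : 0 < \det (expm C t).
Proof.
rewrite [t]splitr expmD det_mulmx -expr2 exprn_even_gt0 //=.
apply/eqP => d0; have /eqP := det1 R n.
by rewrite -(expmKN C (t / 2)) det_mulmx d0 mul0r eq_sym oner_eq0.
Qed.
End MatrixExponential.

(** * Tangent spaces of products of exponentials *)

(** Words carry positive times only, so derivatives at [0] have to be read off from the right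
    half-line. *)
Lemma is_derive_eq0_right (R : realType) (f : R -> R) (a : R) :
  is_derive (0 : R) (1 : R) f a -> (forall t, 0 <= t -> f t = 0) -> a = 0.
Proof.
move=> [df <-] f0.
have h : h^-1 *: (f (h *: (1 : R) + 0) - f 0) @[h --> 0^'+] --> 'D_1 f (0 : R).
  by apply: cvg_dnbhs_at_right; exact: df.
apply: (cvg_unique _ h) => //.
apply: cvg_near_cst.
near=> t; rewrite f0 // ?f0 ?subrr ?scaler0 // addr0.
by rewrite /GRing.scale /= mulr1.
Unshelve. all: by end_near. Qed.

Lemma is_derive_mx_memv (R : realType) n (X : R -> 'M[R]_n) (D : 'M[R]_n)
    (W : {vspace 'M[R]_n}) :
  is_derive_mx X 0 D -> (forall t, 0 <= t -> X t \in W) -> D \in W.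
Proof.
move=> dX XW; suff E : D - projv W D = 0.
  by move/eqP: E; rewrite subr_eq0 => /eqP ->; exact: memv_proj.
apply/matrixP => i j; rewrite [RHS]mxE.
(* Each entry of [M - projv W M] is a fixed linear combination of the entries of [M], with
   coefficients [c], and therefore commutes with differentiation. *)
pose c k l : R := (delta_mx k l - projv W (delta_mx k l)) i j.
have E M : (M - projv W M) i j = \sum_k \sum_l M k l * c k l.
  rewrite {1 2}[M]matrix_sum_delta linear_sum /= -sumrB summxE.
  apply: eq_bigr => k _; rewrite linear_sum /= -sumrB summxE.
  by apply: eq_bigr => l _; rewrite linearZ /= -scalerBr mxE.
rewrite E; apply: (@is_derive_eq0_right _ (fun t => (X t - projv W (X t)) i j)).
  rewrite (_ : (fun t => _) =
    \sum_k \sum_l (c k l \*: (fun t => X t k l))).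
    apply: (is_derive_eq (is_derive_sum (fun k =>
      is_derive_sum (fun l => is_deriveZ (c k l) (dX k l))))).
    by do 2!apply: eq_bigr => ? _; rewrite mulrC.
  apply/funext => t; rewrite E fct_sumE; apply: eq_bigr => k _.
  by rewrite fct_sumE; apply: eq_bigr => l _; rewrite mulrC.
by move=> t /XW/projv_id ->; rewrite subrr mxE.
Qed.

Section Words.
Variables (R : realType) (n : nat).
Implicit Types (C M : 'M[R]_n) (t : R) (w v : seq ('M[R]_n * R)).

(** The head of a word is the leftmost factor, that is, the last letter run in time. *)
Fixpoint flow w : 'M[R]_n :=
  if w is (C, t) :: w' then expm C t *m flow w' else 1%:M.

Fixpoint flowV w : 'M[R]_n :=
  if w is (C, t) :: w' then flowV w' *m expm C (- t) else 1%:M.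

Lemma flowVK w : flowV w *m flow w = 1%:M.
Proof.
elim: w => [|[C t] w IH] /=; first by rewrite mul1mx.
by rewrite mulmxA -(mulmxA (flowV w)) expmNK mulmx1.
Qed.

Lemma det_flow_gt0 w : 0 < \det (flow w).
Proof.
elim: w => [|[C t] w IH] /=; first by rewrite det1.
by rewrite det_mulmx mulr_gt0 // det_expm_gt0.
Qed.

Definition Ad_expm C t : 'End('M[R]_n) :=
  linfun (mulmxr (expm C (- t)) \o mulmx (expm C t)).

Lemma Ad_expmE C t M : Ad_expm C t M = expm C t *m M *m expm C (- t).
Proof. by rewrite lfunE. Qed.

Lemma Ad_expmK C t M : expm C (- t) *m Ad_expm C t M *m expm C t = M.
Proof. by rewrite Ad_expmE !mulmxA expmNK mul1mx -mulmxA expmNK mulmx1. Qed.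

(* Right-translated partial derivatives of [flow w] in the switching times. *)
Fixpoint tangents w : seq 'M[R]_n :=
  if w is (C, t) :: w' then C :: map (Ad_expm C t) (tangents w') else [::].

Lemma size_tangents w : size (tangents w) = size w.
Proof. by elim: w => [|[C t] w IH] //=; rewrite size_map IH. Qed.

Lemma dim_Ad_expm C t (W : {vspace 'M[R]_n}) :
  \dim (Ad_expm C t @: W)%VS = \dim W.
Proof.
apply: limg_dim_eq; suff -> : lker (Ad_expm C t) = 0%VS by rewrite capv0.
apply/eqP/lker0P => M M' /(congr1 (fun N => expm C (- t) *m N *m expm C t)).
by rewrite !Ad_expmK.
Qed.

Variable F : 'M[R]_n -> Prop.

Fixpoint admissible w : Prop :=
  if w is (C, t) :: w' then [/\ F C, 0 < t & admissible w'] else True.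

Definition maximal_word w : Prop :=
  admissible w /\ forall v, admissible v ->
    (\dim <<tangents v>> <= \dim <<tangents w>>)%N.

Lemma exists_maximal_word : exists w, maximal_word w.
Proof.
pose P d := `[< exists2 w, admissible w & d = \dim <<tangents w>>%VS >].
have P0 : exists d, P d.
  by exists (\dim <<tangents [::]>>%VS); apply/asboolP; exists [::].
have Pmax d : P d -> (d <= \dim {: 'M[R]_n})%N.
  by move=> /asboolP[w _ ->]; apply: dimvS; exact: subvf.
case: (ex_maxnP P0 Pmax) => d /asboolP[w aw dE] dmax.
by exists w; split=> // v av; rewrite -dE; apply: dmax; apply/asboolP; exists v.
Qed.

(** The [Ad] image of the old span lies in the new one and has the same dimension, so maximality
    forces equality. *)
Lemma maximal_word_cons C t w : maximal_word w -> F C -> 0 < t ->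
  maximal_word ((C, t) :: w) /\
  <<tangents ((C, t) :: w)>>%VS = (Ad_expm C t @: <<tangents w>>)%VS.
Proof.
move=> [aw mw] FC t0; have a1 : admissible ((C, t) :: w) by [].
have sub : (Ad_expm C t @: <<tangents w>> <= <<tangents ((C, t) :: w)>>)%VS.
  by rewrite limg_span /= span_cons addvSr.
have E : (Ad_expm C t @: <<tangents w>>)%VS = <<tangents ((C, t) :: w)>>%VS.
  by apply/eqP; rewrite eqEdim sub dim_Ad_expm mw.
split=> //; split=> // v av; rewrite -E dim_Ad_expm; exact: mw.
Qed.

(** Prolonging by [C] itself puts [C] into [Ad (e^C) W], and [Ad (e^C)] fixes [C]. *)
Lemma maximal_word_dir C w : maximal_word w -> F C -> C \in <<tangents w>>%VS.
Proof.
move=> mw FC; have [_ E] := maximal_word_cons mw FC ltr01.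
have : C \in <<tangents ((C, 1) :: w)>>%VS by apply: memv_span; rewrite inE eqxx.
rewrite E => /memv_imgP[M MW]; rewrite Ad_expmE => CE.
suff <- : M = C by [].
rewrite -[LHS](Ad_expmK C 1) Ad_expmE -CE -mulmxA -expm_comm.
by rewrite mulmxA expmNK mul1mx.
Qed.

Lemma maximal_word_cat v w : maximal_word w -> admissible v ->
  maximal_word (v ++ w) /\
  forall M, M \in <<tangents (v ++ w)>>%VS ->
    flowV v *m M *m flow v \in <<tangents w>>%VS.
Proof.
move=> mw; elim: v => [_|[C t] v IH /= [FC t0 /IH[mvw Hv]]].
  by split=> // M; rewrite mul1mx mulmx1.
have [m1 E] := maximal_word_cons mvw FC t0.
split=> // M; rewrite E => /memv_imgP[M' M'W ->].
by have := Hv _ M'W; rewrite -{1}(Ad_expmK C t M') !mulmxA.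
Qed.

Variable w : seq ('M[R]_n * R).
Hypothesis mw : maximal_word w.

(** The subspace [K]. Quantifying over all [v] makes the words [(C, t) :: v] available for
    differentiation in [t]. *)
Definition stable_tangent M : Prop :=
  forall v, admissible v -> flowV v *m M *m flow v \in <<tangents w>>%VS.

Lemma stable_tangent_submodule : submodule stable_tangent.
Proof.
split=> [v _|A B hA hB v av|a A hA v av].
- by rewrite mulmx0 mul0mx mem0v.
- by rewrite mulmxDr mulmxDl memvD ?hA ?hB.
- by rewrite -scalemxAr -scalemxAl memvZ ?hA.
Qed.

Lemma stable_tangent_dir C : F C -> stable_tangent C.
Proof.
move=> FC v av; have [mvw] := maximal_word_cat mw av; apply.
exact: maximal_word_dir.
Qed.

(** For [t > 0], transporting [e^(-tC) M e^(tC)] along [v] is transporting [M] along [(C, t) :: v],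
    which stays in the span. The derivative at [0] is the transport of [- [C, M]]. *)
Lemma stable_tangent_bracket C M : F C -> stable_tangent M ->
  stable_tangent (mxbracket C M).
Proof.
move=> FC sM v av.
have dX : is_derive_mx (fun t => expm C (- t) *m M *m expm C t) 0 (- mxbracket C M).
  have := is_derive_mxM (is_derive_mxM (is_derive_expmN C 0) (is_derive_mx_cst M 0))
    (is_derive_expm C 0).
  by rewrite oppr0 expm0 !mul1mx !mulmx1 addr0 mulNmx /mxbracket opprB addrC.
have := is_derive_mxM (is_derive_mxM (is_derive_mx_cst (flowV v) 0) dX)
  (is_derive_mx_cst (flow v) 0).
rewrite oppr0 expm0 !(mul0mx, mulmx0, add0r, addr0) => dY.
have := is_derive_mx_memv (W := <<tangents w>>%VS) dY.
rewrite mulmxN mulNmx memvN; apply=> t; rewrite le_eqVlt => /predU1P[<-|t0].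
  by rewrite oppr0 expm0 mul1mx mulmx1; exact: sM.
have av1 : admissible ((C, t) :: v) by [].
by have := sM _ av1; rewrite /= !mulmxA.
Qed.
End Words.

Section FullWord.
Variables (R : realType) (n m : nat) (B0 : 'M[R]_n) (B : 'I_m -> 'M[R]_n).

Definition directions (C : 'M[R]_n) : Prop :=
  exists c : 'I_m -> R, C = B0 + \sum_i c i *: B i.

Hypothesis lie_generated : forall S : 'M[R]_n -> Prop, lie_subalgebra S ->
  S B0 -> (forall i, S (B i)) -> forall M, S M.

Lemma exists_full_word : exists2 w, admissible directions w &
  <<tangents w>>%VS = fullv.
Proof.
have [w mw] := exists_maximal_word directions; exists w; first by case: mw.
pose K := stable_tangent directions w.
(* [K] is known to be stable only under brackets with directions. Its elements that normalise [K]
   form a Lie subalgebra by the Jacobi identity. *)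
pose S X := K X /\ forall M, K M -> K (mxbracket X M).
have [K0 KD KZ] : submodule K := stable_tangent_submodule _ _.
have dirS C : directions C -> S C.
  move=> dC; split=> [|M]; first exact: stable_tangent_dir.
  exact: stable_tangent_bracket.
have SD X Y : S X -> S Y -> S (X + Y).
  move=> [kX aX] [kY aY]; split=> [|M kM]; first exact: KD.
  by rewrite mxbracketDl; apply: KD; [exact: aX|exact: aY].
have SZ a X : S X -> S (a *: X).
  move=> [kX aX]; split=> [|M kM]; first exact: KZ.
  by rewrite mxbracketZl; apply: KZ; exact: aX.
have SB0 : S B0.
  apply: dirS; exists (fun=> 0).
  by rewrite big1 ?addr0 // => i _; rewrite scale0r.
have Slie : lie_subalgebra S.
  split; first by split=> //; rewrite -(scale0r B0); exact: SZ.
  move=> X Y [kX aX] [kY aY]; split=> [|M kM]; first exact: aX.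
  rewrite mxbracket_jacobi -scaleN1r.
  by apply: KD; [|apply: KZ]; [apply: aX; exact: aY|apply: aY; exact: aX].
have SB i : S (B i).
  (* [B i] is written as the difference of the directions [B0 + B i] and [B0]. *)
  have -> : B i = (B0 + B i) + (-1) *: B0 by rewrite scaleN1r addrAC subrr add0r.
  apply: SD; last exact: SZ.
  apply: dirS; exists (fun j => (j == i)%:R); congr (_ + _).
  rewrite (bigD1 i) //= eqxx scale1r big1 ?addr0 // => j /negbTE ->.
  by rewrite scale0r.
apply/eqP; rewrite eqEsubv subvf; apply/subvP => M _.
have [kM _] := lie_generated Slie SB0 SB M.
by have := kM [::] I; rewrite mul1mx mulmx1.
Qed.
End FullWord.

(** * Strict differentiability *)

Section StrictDifferential.
Variables (R : realType) (V : normedModType R).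
Implicit Types f g L : V -> R.

Definition bounded_form L : Prop := exists2 K : R, 0 <= K &
  forall h, `|L h| <= K * `|h|.

(** Strict differentiability at the origin: the estimate compares two arbitrary nearby points, which
    is what makes [Y - (G Y - Z)] a contraction. *)
Definition strict_diff f L : Prop := bounded_form L /\
  forall e : R, 0 < e -> \forall d \near 0^'+, forall Y Y' : V, `|Y| < d -> `|Y'| < d ->
    `|f Y - f Y' - L (Y - Y')| <= e * `|Y - Y'|.

Lemma strict_diff_cst c : strict_diff (fun=> c) (fun=> 0).
Proof.
split; first by exists 0 => // h; rewrite normr0 mul0r.
by move=> e e0; near=> d => Y Y' _ _; rewrite !subrr normr0 mulr_ge0 // ltW.
Unshelve. all: by end_near. Qed.

Lemma eq_strict_diff f g L L' : f =1 g -> L =1 L' ->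
  strict_diff f L -> strict_diff g L'.
Proof. by move=> /funext -> /funext ->. Qed.

Lemma strict_diff_near f L e : strict_diff f L -> 0 < e ->
  \forall d \near 0^'+, forall Y : V, `|Y| < d -> `|f Y - f 0| <= e.
Proof.
move=> [[K K0 bL] df] e0; near=> d => Y Yd.
have d0 : 0 < d by near: d; exact: nbhs_right_gt.
have h : `|f Y - f 0 - L (Y - 0)| <= 1 * `|Y - 0|.
  have : forall Y Y' : V, `|Y| < d -> `|Y'| < d ->
    `|f Y - f Y' - L (Y - Y')| <= 1 * `|Y - Y'|.
    by near: d; exact: df.
  by apply; rewrite ?normr0.
rewrite subr0 mul1r in h.
have -> : f Y - f 0 = (f Y - f 0 - L Y) + L Y by rewrite subrK.
apply: (le_trans (ler_normD _ _)); apply: (le_trans (lerD h (bL Y))).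
have dK : d <= e / (1 + K).
  by near: d; apply: nbhs_right_le; rewrite divr_gt0 // ltr_wpDr.
have : `|Y| <= e / (1 + K) by rewrite (le_trans (ltW Yd)).
by rewrite ler_pdivlMr ?ltr_wpDr // mulrDr mulr1 [K * _]mulrC.
Unshelve. all: by end_near. Qed.

Lemma strict_diffD f g L L' : strict_diff f L -> strict_diff g L' ->
  strict_diff (fun Y => f Y + g Y) (fun h => L h + L' h).
Proof.
move=> [[K K0 bL] df] [[K' K0' bL'] dg]; split.
  exists (K + K'); first exact: addr_ge0.
  by move=> h; rewrite mulrDl (le_trans (ler_normD _ _)) // lerD.
move=> e e0; near=> d => Y Y' Yd Y'd.
have h1 : `|f Y - f Y' - L (Y - Y')| <= e / 2 * `|Y - Y'|.
  by move: Y Y' Yd Y'd; near: d; apply: df; rewrite divr_gt0.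
have h2 : `|g Y - g Y' - L' (Y - Y')| <= e / 2 * `|Y - Y'|.
  by move: Y Y' Yd Y'd {h1}; near: d; apply: dg; rewrite divr_gt0.
rewrite [e]splitr mulrDl; apply: le_trans (lerD h1 h2).
apply: le_trans (ler_normD _ _); rewrite le_eqVlt; apply/orP; left; apply/eqP.
by congr `|_|; ring.
Unshelve. all: by end_near. Qed.

Lemma strict_diff_sum (I : Type) (s : seq I) (f L : I -> V -> R) :
  (forall i, strict_diff (f i) (L i)) ->
  strict_diff (fun Y => \sum_(i <- s) f i Y) (fun h => \sum_(i <- s) L i h).
Proof.
move=> df; elim: s => [|i s IH].
  by apply: eq_strict_diff (strict_diff_cst 0) => Y; rewrite big_nil.
apply: (eq_strict_diff _ _ (strict_diffD (df i) IH)) => Y; by rewrite big_cons.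
Qed.

Lemma strict_diffM f g L L' : strict_diff f L -> strict_diff g L' ->
  strict_diff (fun Y => f Y * g Y) (fun h => L h * g 0 + f 0 * L' h).
Proof.
move=> sf sg; have [[K K0 bL] df] := sf; have [[K' K0' bL'] dg] := sg; split.
  exists (K * `|g 0| + `|f 0| * K').
    by rewrite addr_ge0 // mulr_ge0.
  move=> h; rewrite mulrDl (le_trans (ler_normD _ _)) // !normrM lerD //.
    by rewrite mulrAC ler_wpM2r.
  by rewrite -mulrA ler_wpM2l.
move=> e e0.
(* [A] collects the factors of [e1] in the bounds of the four terms into which the error of the
   product is split below. *)
pose A := (`|g 0| + 1) + K + (`|f 0| + 1) + K'.
have A0 : 0 < A.
  have := normr_ge0 (g 0); have := normr_ge0 (f 0); rewrite /A; lra.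
pose e1 := e / A; have e10 : 0 < e1 by rewrite divr_gt0.
near=> d => Y Y' Yd Y'd.
have h1 : `|f Y - f Y' - L (Y - Y')| <= e1 * `|Y - Y'|.
  by move: Y Y' Yd Y'd; near: d; apply: df.
have h2 : `|g Y - g Y' - L' (Y - Y')| <= e1 * `|Y - Y'|.
  by move: Y Y' Yd Y'd {h1}; near: d; apply: dg.
have h3 : `|g Y - g 0| <= e1.
  by move: Y Yd {Y'd h1 h2}; near: d; apply: strict_diff_near sg _.
have h4 : `|f Y' - f 0| <= e1.
  by move: Y' Y'd {Yd h1 h2}; near: d; apply: strict_diff_near sf _.
have h5 : `|g Y| <= `|g 0| + 1.
  have : `|g Y - g 0| <= 1.
    by move: Y Yd {Y'd h1 h2 h3}; near: d; apply: strict_diff_near sg _.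
  by have := ler_normD (g Y - g 0) (g 0); rewrite subrK; lra.
have h6 : `|f Y'| <= `|f 0| + 1.
  have : `|f Y' - f 0| <= 1.
    by move: Y' Y'd {Yd h1 h2 h4}; near: d; apply: strict_diff_near sf _.
  by have := ler_normD (f Y' - f 0) (f 0); rewrite subrK; lra.
set D := `|Y - Y'| in h1 h2 *.
have D0 : 0 <= D by exact: normr_ge0.
have -> : f Y * g Y - f Y' * g Y' - (L (Y - Y') * g 0 + f 0 * L' (Y - Y')) =
  (f Y - f Y' - L (Y - Y')) * g Y + L (Y - Y') * (g Y - g 0) +
  f Y' * (g Y - g Y' - L' (Y - Y')) + (f Y' - f 0) * L' (Y - Y') by ring.
apply: (@le_trans _ _ (e1 * D * (`|g 0| + 1) + K * D * e1 +
    (`|f 0| + 1) * (e1 * D) + e1 * (K' * D))).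
  apply: (le_trans (ler_normD _ _)); apply: lerD; last by rewrite normrM ler_pM.
  apply: (le_trans (ler_normD _ _)); apply: lerD; last by rewrite normrM ler_pM.
  by apply: (le_trans (ler_normD _ _)); apply: lerD; rewrite normrM ler_pM.
have -> : e = e1 * A by rewrite /e1 divfK // gt_eqF.
rewrite le_eqVlt; apply/orP; left; apply/eqP; rewrite /A; ring.
Unshelve. all: by end_near. Qed.

(** By the mean value theorem the difference quotient is a value of [dphi] near [t0], which
    continuity keeps close to [dphi t0]. *)
Lemma strict_derivative (phi dphi : R -> R) (t0 e : R) :
  (forall t, is_derive t (1 : R) phi (dphi t)) -> {for t0, continuous dphi} ->
  0 < e -> \forall d \near 0^'+, forall s s', `|s - t0| < d -> `|s' - t0| < d ->
    `|phi s - phi s' - dphi t0 * (s - s')| <= e * `|s - s'|.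
Proof.
move=> dphiE cont e0.
have cphi : continuous phi.
  by move=> t; apply/differentiable_continuous/derivable1_diffP; case: (dphiE t).
move/cvgrPdist_le : cont => /(_ e e0) /nbhs_ballP[d0 /= d00 Hd0].
near=> d.
have dd0 : d <= d0 by near: d; apply: nbhs_right_le.
have main s s' : s' < s -> `|s - t0| < d -> `|s' - t0| < d ->
    `|phi s - phi s' - dphi t0 * (s - s')| <= e * `|s - s'|.
  move=> ss' sd s'd.
  have [|c + ->] := @MVT _ phi dphi s' s ss' (fun x _ => dphiE x).
    exact: continuous_subspaceT.
  rewrite in_itv /= => /andP[s'c cs].
  rewrite -mulrBl normrM ler_wpM2r // distrC; apply: Hd0.
  rewrite /ball /= distrC; apply: lt_le_trans dd0.
  by move: sd s'd; rewrite !ltr_norml => /andP[? ?] /andP[? ?]; apply/andP; split; lra.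
move=> s s' sd s'd; have [ss'|ss'|->] := ltgtP s s'; last 2 first.
- exact: main.
- by rewrite !subrr mulr0 subrr normr0 mulr0.
have -> : phi s - phi s' - dphi t0 * (s - s') =
  - (phi s' - phi s - dphi t0 * (s' - s)) by ring.
by rewrite normrN (distrC s); exact: main.
Unshelve. all: by end_near. Qed.

Lemma strict_diff_comp (phi dphi : R -> R) (t0 : R) (a : V -> R) :
  (forall t, is_derive t (1 : R) phi (dphi t)) -> {for t0, continuous dphi} ->
  bounded_form a -> (forall Y Y', a (Y - Y') = a Y - a Y') ->
  strict_diff (fun Y => phi (t0 + a Y)) (fun h => a h * dphi t0).
Proof.
move=> dphiE cont [K K0 ba] aB; split.
  exists (K * `|dphi t0|); first exact: mulr_ge0.
  by move=> h; rewrite normrM mulrAC ler_wpM2r.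
move=> e e0; have K1 : 0 < K + 1 by rewrite ltr_wpDl.
have e1 : 0 < e / (K + 1) by rewrite divr_gt0.
have [d1 /= d10 Hd1] : exists2 d1 : R, 0 < d1 &
    forall s s', `|s - t0| < d1 -> `|s' - t0| < d1 ->
    `|phi s - phi s' - dphi t0 * (s - s')| <= e / (K + 1) * `|s - s'|.
  near (0 : R)^'+ => d1; exists d1; first by near: d1; exact: nbhs_right_gt.
  by near: d1; exact: strict_derivative.
near=> d => Y Y' Yd Y'd.
have dK : d <= d1 / (K + 1) by near: d; apply: nbhs_right_le; rewrite divr_gt0.
have small Z : `|Z| < d -> `|t0 + a Z - t0| < d1.
  move=> Zd; rewrite addrAC subrr add0r; apply: (le_lt_trans (ba Z)).
  have : `|Z| < d1 / (K + 1) by apply: lt_le_trans dK.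
  by rewrite ltr_pdivlMr // mulrDr mulr1; have := normr_ge0 Z; rewrite mulrC; lra.
have := Hd1 _ _ (small _ Yd) (small _ Y'd).
have -> : t0 + a Y - (t0 + a Y') = a (Y - Y') by rewrite aB; ring.
rewrite [dphi t0 * _]mulrC => h; apply: (le_trans h).
rewrite mulrAC ler_pdivrMr // -mulrA; apply: ler_wpM2l; first exact: ltW.
apply: (le_trans (ba _)); rewrite mulrC ler_wpM2l //; lra.
Unshelve. all: by end_near. Qed.
End StrictDifferential.

(** * Strict differential of a product of exponentials *)

Section StrictMatrix.
Variables (R : realType) (n : nat).
Local Notation V := 'M[R]_n.
Implicit Types (G : V -> V) (L : V -> V).

Definition strict_diff_mx G L : Prop :=
  forall i j, strict_diff (fun Y => G Y i j) (fun h => L h i j).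

Lemma strict_diff_mxM G G' L L' : strict_diff_mx G L -> strict_diff_mx G' L' ->
  strict_diff_mx (fun Y => G Y *m G' Y) (fun h => L h *m G' 0 + G 0 *m L' h).
Proof.
move=> dG dG' i j.
apply: (@eq_strict_diff _ _ (fun Y => \sum_k G Y i k * G' Y k j) _
    (fun h => \sum_k (L h i k * G' 0 k j + G 0 i k * L' h k j))).
- by move=> Y; rewrite mxE.
- by move=> h; rewrite !mxE big_split.
by apply: strict_diff_sum => k; exact: strict_diffM.
Qed.

Lemma strict_diff_expm (C : V) (t : R) (a : V -> R) :
  bounded_form a -> (forall Y Y', a (Y - Y') = a Y - a Y') ->
  strict_diff_mx (fun Y => expm C (t + a Y)) (fun h => a h *: (C *m expm C t)).
Proof.
move=> ba aB i j.
apply: (@eq_strict_diff _ _ (fun Y => expm C (t + a Y) i j) _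
  (fun h => a h * (C *m expm C t) i j)) => // [h|]; first by rewrite [RHS]mxE.
apply: (@strict_diff_comp _ _ (fun s => expm C s i j)
  (fun s => (C *m expm C s) i j)) => //.
  by move=> s; exact: is_derive_expm.
have [] := is_derive_mxM (is_derive_mx_cst C t) (is_derive_expm C t) i j.
by move=> h _; apply/differentiable_continuous/derivable1_diffP.
Qed.

Lemma mx_entry_norm (M : V) i j : `|M i j| <= `|M|.
Proof. by rewrite [leRHS]/Num.Def.normr /= mx_normrE; exact: (le_bigmax _ _ (i, j)). Qed.

Lemma mx_norm_le (M : V) e : 0 <= e -> (forall i j, `|M i j| <= e) -> `|M| <= e.
Proof.
move=> e0 h; rewrite [leLHS]/Num.Def.normr /= mx_normrE.
by apply: bigmax_le => // -[i j] _; exact: h.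
Qed.

Lemma scalar_bounded (a : {scalar V}) : bounded_form a.
Proof.
exists (\sum_i \sum_j `|a (delta_mx i j)|); first by do 2!apply: sumr_ge0 => ? _.
move=> h; rewrite {1}[h]matrix_sum_delta linear_sum mulr_suml.
apply: (le_trans (ler_norm_sum _ _ _)); apply: ler_sum => i _.
rewrite linear_sum mulr_suml.
apply: (le_trans (ler_norm_sum _ _ _)); apply: ler_sum => j _.
by rewrite linearZ /= normrM mulrC ler_wpM2l // mx_entry_norm.
Qed.

(** The times are shifted by functions of a matrix [Y], so that the flow becomes a map from matrices
    to matrices whatever the length of the word. *)
Fixpoint perturb (w : seq (V * R)) (a : nat -> V -> R) (Y : V) : seq (V * R) :=
  if w is (C, t) :: w' then (C, t + a 0%N Y) :: perturb w' (fun k => a k.+1) Y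
  else [::].

Lemma perturb0 w (a : nat -> V -> R) : (forall k, a k 0 = 0) -> perturb w a 0 = w.
Proof.
by elim: w a => [|[C t] w IH] a a0 //=; rewrite a0 addr0 IH.
Qed.

(** Product rule: moving [e^(tC)] to the right past the tangents of the tail conjugates them, which
    produces the [Ad_expm] of [tangents]. *)
Lemma strict_diff_flow w (a : nat -> V -> R) :
  (forall k, bounded_form (a k)) ->
  (forall k Y Y', a k (Y - Y') = a k Y - a k Y') ->
  strict_diff_mx (fun Y => flow (perturb w a Y))
    (fun h => (\sum_(k < size w) a k h *: (tangents w)`_k) *m flow w).
Proof.
move=> ba aB; elim: w a ba aB => [|[C t] w IH] a ba aB.
  move=> i j; apply: (@eq_strict_diff _ _ (fun=> (1%:M : V) i j) _ (fun=> 0)) => //.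
    by move=> h; rewrite big_ord0 mul0mx mxE.
  exact: strict_diff_cst.
have a0 k : a k 0 = 0 by rewrite -(subrr 0) aB subrr.
have := strict_diff_mxM (strict_diff_expm C t (ba 0%N) (aB 0%N))
  (IH _ (fun k => ba k.+1) (fun k => aB k.+1)).
rewrite /= a0 addr0 perturb0 //.
move=> H i j; apply: eq_strict_diff (H i j) => // h.
congr (fun_of_matrix _ i j); rewrite big_ord_recl /= mulmxDl; congr (_ + _).
  by rewrite -!scalemxAl mulmxA.
rewrite !mulmxA; congr (_ *m _); rewrite mulmx_sumr mulmx_suml.
apply: eq_bigr => k _; rewrite (nth_map 0) ?size_tangents ?add0n // Ad_expmE.
by rewrite -scalemxAr -scalemxAl -mulmxA expmNK mulmx1.
Qed.
End StrictMatrix.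

HB.instance Definition _ (R : realType) (m n : nat) := Complete.on 'M[R]_(m, n).

(* [G Y = Z] is solved as a fixed point of [Y - (G Y - Z)]. *)
Lemma strict_diff_open (R : realType) n (G : 'M[R]_n -> 'M[R]_n) (d : R) :
  strict_diff_mx G id -> 0 < d -> exists2 r : R, 0 < r &
    forall Z, `|Z - G 0| < r -> exists2 Y, `|Y| <= d & G Y = Z.
Proof.
move=> sG d0.
have [e [e0 ed He]] : exists e : R, [/\ 0 < e, e <= d & forall Y Y' : 'M[R]_n,
    `|Y| <= e -> `|Y'| <= e -> `|G Y - G Y' - (Y - Y')| <= 2^-1 * `|Y - Y'|].
  have H : \forall x \near (0 : R)^'+, forall ij : 'I_n * 'I_n, forall Y Y' : 'M[R]_n,
     `|Y| < x -> `|Y'| < x ->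
     `|G Y ij.1 ij.2 - G Y' ij.1 ij.2 - (Y - Y') ij.1 ij.2| <= 2^-1 * `|Y - Y'|.
    by apply: filter_forall => -[i' j'] /=; apply: (sG i' j').2.
  near (0 : R)^'+ => e1.
  have e10 : 0 < e1 by near: e1; exact: nbhs_right_gt.
  have e1d : e1 <= d by near: e1; exact: nbhs_right_le.
  (* Halving the radius turns the open ball of the estimate into a closed one, as the fixed point
     theorem asks for a closed set. *)
  exists (e1 / 2); split=> [||Y Y' Yd Y'd]; [lra|lra|].
  have {Yd}Yd : `|Y| < e1 by lra.
  have {Y'd}Y'd : `|Y'| < e1 by lra.
  apply: mx_norm_le => [|i j]; first by rewrite mulr_ge0.
  rewrite !mxE -[X in _ - X](_ : (Y - Y') i j = _); last by rewrite !mxE.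
  exact: (near H e1 _ (i, j)).
(* The map [f] below halves distances and [f 0 = Z - G 0], so [e / 2] is the room left for it to
   preserve the ball of radius [e]. *)
exists (e / 2); first by lra.
move=> Z HZ; pose U : set 'M[R]_n := [set Y | `|Y| <= e].
pose f (Y : 'M[R]_n) := Y - (G Y - Z).
have lipf Y Y' : `|Y| <= e -> `|Y'| <= e -> `|f Y - f Y'| <= 2^-1 * `|Y - Y'|.
  move=> hY hY'; have -> : f Y - f Y' = - (G Y - G Y' - (Y - Y')).
    by apply/matrixP => i j; rewrite !mxE; ring.
  by rewrite normrN; exact: He.
have fU : set_fun U U f.
  move=> Y /= hY; have h0 : `|0 : 'M[R]_n| <= e by rewrite normr0 ltW.
  have := lipf _ _ hY h0; rewrite subr0 => h.
  have -> : f Y = (f Y - f 0) + f 0 by rewrite subrK.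
  apply: (le_trans (ler_normD _ _)).
  have f0 : f 0 = Z - G 0 by rewrite /f sub0r opprB.
  rewrite f0 in h *.
  by apply: (le_trans (lerD h (ltW HZ))); move: hY; rewrite /U /=; lra.
have clU : closed U.
  rewrite (_ : U = (fun Y : 'M[R]_n => `|Y|) @^-1` [set x : R | x <= e]) //.
  by apply: (preimage_closed _ (@closed_le _ _)) => y _; exact: norm_continuous.
pose F : {fun U >-> U} := mkfun_fun fU.
have [||Y hY YE] := @banach_fixed_point R 'M[R]_n U F _ clU.
- exists (2^-1)%:nng; split; first by rewrite /=; lra.
  by move=> -[Y Y'] /= [hY hY']; exact: lipf.
- by exists 0; rewrite /U /= normr0 ltW.
exists Y; first exact: le_trans ed.
have {}YE : Y = Y - (G Y - Z) := YE.
by move/eqP: YE; rewrite -subr_eq0 subKr subr_eq0 => /eqP.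
Unshelve. all: by end_near. Qed.

(** * Reachability by piecewise constant controls *)

Lemma perturb_admissible (R : realType) n (F : 'M[R]_n -> Prop)
    (w : seq ('M[R]_n * R)) (a : nat -> 'M[R]_n -> R) :
  admissible F w -> (forall k, bounded_form (a k)) ->
  \forall d \near 0^'+, forall Y, `|Y| <= d -> admissible F (perturb w a Y).
Proof.
elim: w a => [|[C t] w IH] a /=; first by move=> _ _; near=> d.
move=> [FC t0 aw] ba; have [K K0 bK] := ba 0%N.
have K1 : 0 < K + 1 by rewrite ltr_wpDl.
near=> d => Y Yd; split=> //.
  (* This radius keeps the shift of the first time below [t]; [K + 1] replaces [K], which may be
     zero. *)
  have dK : d < t / (K + 1) by near: d; apply: nbhs_right_lt; rewrite divr_gt0.
  have : `|Y| < t / (K + 1) by apply: le_lt_trans dK.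
  rewrite ltr_pdivlMr // => Yt.
  have : `|a 0%N Y| < t.
    apply: (le_lt_trans (bK Y)).
    by move: Yt (normr_ge0 Y); rewrite mulrC; lra.
  by rewrite ltr_norml => /andP[]; lra.
move: Y Yd; near: d; apply: IH => // k; exact: ba.
Unshelve. all: by end_near. Qed.

(** The time shifts are the coordinates of [Y *m flowV w] in the spanning family of tangents, so the
    differential of the perturbed flow is the identity. *)
Lemma flow_open (R : realType) n (F : 'M[R]_n -> Prop) (w : seq ('M[R]_n * R)) :
  admissible F w -> <<tangents w>>%VS = fullv ->
  exists2 r : R, 0 < r & forall Z, `|Z - flow w| < r ->
    exists2 v, admissible F v & flow v = Z.
Proof.
move=> aw full; pose T := in_tuple (tangents w).
pose b (i : 'I_(size (tangents w))) : {scalar 'M[R]_n} :=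
  coord T i \o mulmxr (flowV w).
(* [perturb] takes shifts indexed by all naturals, hence the value zero beyond the length of the
   word. *)
pose a k : 'M[R]_n -> R := if insub k is Some i then b i else fun=> 0.
have ba k : bounded_form (a k).
  rewrite /a; case: insubP => [i _ _|_]; first exact: scalar_bounded.
  by exists 0 => // h; rewrite normr0 mul0r.
have aB k Y Y' : a k (Y - Y') = a k Y - a k Y'.
  by rewrite /a; case: insubP => [i _ _|_]; [exact: linearB|rewrite subr0].
have a0 k : a k 0 = 0 by rewrite -(subrr 0) aB subrr.
have sG : strict_diff_mx (fun Y => flow (perturb w a Y)) id.
  move=> i j; apply: eq_strict_diff (strict_diff_flow w ba aB i j) => // h.
  congr (fun_of_matrix _ i j).
  have := @coord_span _ _ _ T (h *m flowV w); rewrite full memvf => /(_ isT) E.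
  rewrite -[size w]size_tangents (_ : \sum_(k < _) _ = h *m flowV w); last first.
    rewrite [RHS]E; apply: eq_bigr => k _; congr (_ *: _).
    by rewrite /a; case: insubP => [k' _ /val_inj -> //|]; rewrite ltn_ord.
  by rewrite -mulmxA flowVK mulmx1.
near (0 : R)^'+ => d.
have d0 : 0 < d by near: d; exact: nbhs_right_gt.
have [r r0 Hr] := strict_diff_open sG d0.
exists r => // Z; rewrite -{1}(perturb0 w a0) => /Hr[Y Yd <-].
exists (perturb w a Y) => //.
by move: Y Yd; near: d; exact: perturb_admissible.
Unshelve. all: by end_near. Qed.

Section Pieces.
Variable R : realType.

Lemma pieces_rcons (p : seq R) (x : R) :
  pieces (rcons p x) = rcons (pieces p) (last 0 p, x).
Proof.
rewrite /pieces; elim: p 0 => [|y p IH] a //=.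
by rewrite -IH.
Qed.

Lemma pieces_le_last (p : seq R) ab : path <%R 0 p -> ab \in pieces p ->
  ab.2 <= last 0 p.
Proof.
rewrite /pieces; elim: p 0 => [|y p IH] a //= /andP[ay yp].
rewrite inE => /predU1P[-> /=|]; last exact: IH.
clear -yp; elim: p y yp => [|z p IH] y //= /andP[yz zp].
by apply: le_trans (IH _ zp); exact: ltW.
Qed.
End Pieces.

Lemma continuous_mx_entries (R : realType) n (X : R -> 'M[R]_n) :
  (forall i j, continuous (fun t => X t i j)) -> continuous X.
Proof.
move=> cX t; apply/cvgrPdist_le => e e0.
have H (ij : 'I_n * 'I_n) : \forall s \near t, `|X t ij.1 ij.2 - X s ij.1 ij.2| <= e.
  by have /cvgrPdist_le := cX ij.1 ij.2 t; exact.
have /filterS : \forall s \near t, forall ij : 'I_n * 'I_n,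
    `|X t ij.1 ij.2 - X s ij.1 ij.2| <= e.
  exact: (filter_forall _ H).
apply=> s Hs; apply: mx_norm_le => [|i j]; first exact: ltW.
by rewrite !mxE; exact: (Hs (i, j)).
Qed.

Section Concatenation.
Variables (R : realType) (n m : nat) (B0 : 'M[R]_n) (B : 'I_m -> 'M[R]_n).

(** Induction on the word: its tail is run first, up to time [T], and the head letter is appended as
    one more piece. Continuity on the whole line is carried along for the gluing. *)
Lemma reach_flow w : admissible (directions B0 B) w ->
  exists (T : R) (p : seq R) (u : 'I_m -> R -> R) (X : R -> 'M[R]_n),
    [/\ 0 <= T /\ partition_of T p, forall i, pc_on p (u i),
        X 0 = 1%:M /\ X T = flow w,
        forall i j, continuous (fun t => X t i j) &
        forall ab, ab \in pieces p -> forall t, ab.1 < t < ab.2 ->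
          is_derive t (1 : R) X ((B0 + \sum_(i < m) u i t *: B i) *m X t)].
Proof.
elim: w => [_|[C s] w IH /= [[c CE] s0 /IH{IH}]].
  exists 0, [::], (fun _ _ => 0), (fun=> 1%:M); split=> //.
  by move=> i j t; exact: cvg_cst.
move=> [T [p [u [X [[T0 [pp lp]] pu [X0 XT] cX dX]]]]].
pose u' i t := if t < T then u i t else c i.
(* With [max] and [min] the glued curve is a single formula built from continuous functions; [X'l]
   and [X'r] recover its two branches. *)
pose X' t := expm C (Num.max (t - T) 0) *m X (Num.min t T).
exists (T + s), (rcons p (T + s)), u', X'.
have pT ab : ab \in pieces p -> ab.2 <= T by rewrite -lp; exact: pieces_le_last.
have X'l t : t <= T -> X' t = X t.
  move=> tT; rewrite /X' (max_idPr _) ?subr_le0 // expm0 mul1mx.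
  by rewrite (min_idPl _).
have X'r t : T <= t -> X' t = expm C (t - T) *m X T.
  by move=> Tt; rewrite /X' (max_idPl _) ?subr_ge0 // (min_idPr _).
split.
- split; first by rewrite addr_ge0 // ltW.
  by split; rewrite ?last_rcons // rcons_path pp lp ltrDl.
- move=> i ab; rewrite pieces_rcons mem_rcons inE => /predU1P[-> /=|abp].
    exists (cst (c i)); split; first by apply: continuous_subspaceT => t; exact: cvg_cst.
    by move=> t /andP[]; rewrite lp => Tt _; rewrite /u' ltNge ltW.
  have [g [cg gu]] := pu i ab abp; exists g; split=> // t tab; rewrite /u'.
  case/andP: (tab) => _ tb; rewrite (lt_le_trans tb (pT _ abp)); exact: gu.
- split; first by rewrite X'l.
  rewrite X'r ?lerDl ?ltW // XT; congr (expm C _ *m _).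
  by rewrite addrAC subrr add0r.
- move=> i j t; rewrite /X'.
  rewrite (_ : (fun t => _) = fun t =>
    \sum_k expm C (Num.max (t - T) 0) i k * X (Num.min t T) k j); last first.
    by apply/funext => x; rewrite mxE.
  apply: cvg_big => [|k _]; first exact: add_continuous.
  apply: cvgM.
    apply: (@continuous_comp _ _ _ (fun t => Num.max (t - T) 0) (fun x => expm C x i k)).
      apply: (@continuous_max _ _ (fun t : R => t - T) (fun=> 0)); last exact: cvg_cst.
      by apply: cvgB; [exact: cvg_id|exact: cvg_cst].
    apply/differentiable_continuous/derivable1_diffP.
    by case: (is_derive_expm C (Num.max (t - T) 0) i k).
  apply: (@continuous_comp _ _ _ (fun t => Num.min t T) (fun x => X x k j)).
    apply: (@continuous_min _ _ (fun t : R => t) (fun=> T)); last exact: cvg_cst.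
    exact: cvg_id.
  exact: cX.
- move=> ab; rewrite pieces_rcons mem_rcons inE => /predU1P[-> /=|abp] t.
    rewrite lp => /andP[Tt _].
    have -> : B0 + \sum_(i < m) u' i t *: B i = C.
      rewrite CE; congr (_ + _); apply: eq_bigr => i _.
      by rewrite /u' ltNge ltW.
    apply: (@near_eq_is_derive _ _ _ (fun t => expm C (t - T) *m X T)).
      by near=> x; rewrite X'r // ltW //; near: x; exact: lt_nbhsr.
    rewrite X'r ?ltW //.
    have h1 : is_derive t (1 : R) (fun t => t - T) (1 : R) by exact: is_derive_shift.
    have := is_derive_mxM (is_derive_mx_comp h1 (is_derive_expm C (t - T)))
      (is_derive_mx_cst (X T) t).
    rewrite mulmx0 addr0 scale1r mulmxA => /is_derive_mx_derive[h2 h3].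
    exact: DeriveDef.
  move=> tab; case/andP: (tab) => at_ tb.
  have tT : t < T by exact: lt_le_trans (pT _ abp).
  apply: (@near_eq_is_derive _ _ _ X).
    by near=> x; rewrite X'l // ltW //; near: x; exact: lt_nbhsl.
  rewrite X'l ?ltW //; have := dX ab abp t tab.
  suff -> : \sum_(i < m) u' i t *: B i = \sum_(i < m) u i t *: B i by [].
  by apply: eq_bigr => i _; rewrite /u' tT.
Unshelve. all: by end_near. Qed.

Lemma flow_reachable w : admissible (directions B0 B) w ->
  reach_set B0 B (flow w).
Proof.
move=> /reach_flow[T [p [u [X [[T0 pT] pu [X0 XT] cX dX]]]]].
exists T, u, X; split=> //; split=> //; exists p; split=> //; split=> //; split=> //.
split; first exact/continuous_subspaceT/continuous_mx_entries.
by move=> ab abp t tab; have [] := dX ab abp t tab.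
Qed.

Lemma lie_generated_accessible :
  (forall S : 'M[R]_n -> Prop, lie_subalgebra S ->
     S B0 -> (forall i, S (B i)) -> forall M, S M) -> accessible B0 B.
Proof.
move=> /exists_full_word[w aw full]; have [r r0 Hr] := flow_open aw full.
exists (flow w), (ball (flow w) r); split; first exact: ball_open.
split; first exact: ballxx; split; first exact: det_flow_gt0.
move=> Z [+ _]; rewrite -ball_normE /= distrC => /Hr[v av <-].
exact: flow_reachable.
Qed.
End Concatenation.

(** * The zero patterns *)

Lemma drift_arcE (R : realType) n (alpha : basis_subset n) i j :
  drift_arc R alpha i j = ((i, j) \in alpha).
Proof.
apply/existsP/idP => [[[k l] /= /andP[kla]]|ija]; last first.
  by exists (i, j); rewrite ija /= delta_mxE !eqxx oner_eq0.
rewrite delta_mxE; case: andP => [[/eqP -> /eqP ->] //|_].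
by rewrite eqxx.
Qed.

Lemma sum_deltaE (R : pzRingType) n (alpha : basis_subset n)
    (l : 'I_n * 'I_n -> R) i j :
  (\sum_(p in alpha) l p *: delta_mx p.1 p.2 : 'M[R]_n) i j =
  if (i, j) \in alpha then l (i, j) else 0.
Proof.
have z p : p != (i, j) -> (l p *: delta_mx p.1 p.2 : 'M[R]_n) i j = 0.
  case: p => k k' /= ne; rewrite mxE delta_mxE.
  have [ik|_] := eqVneq i k; have [jk|_] /= := eqVneq j k'; rewrite ?mulr0 //.
  by rewrite ik jk eqxx in ne.
rewrite summxE; case: ifPn => [ija|ija].
  rewrite (bigD1 (i, j)) //= big1 ?addr0; last by move=> p /andP[_]; exact: z.
  by rewrite mxE delta_mxE !eqxx mulr1.
by rewrite big1 // => p pa; apply: z; apply: contraNneq ija => <-.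
Qed.

(** Brackets compose the arcs of a path. Since [lie_delta_trans] needs distinct ends, an initial
    loop is skipped and a tail that returns to its own start is cut. *)
Lemma lie_delta_connect (R : realFieldType) n (S : 'M[R]_n -> Prop)
    (e : rel 'I_n) : lie_subalgebra S ->
  (forall i j, e i j -> S (delta_mx i j)) ->
  forall i j, i != j -> connect e i j -> S (delta_mx i j).
Proof.
move=> Slie Se i j + /connectP[p + jE]; rewrite {}jE.
elim: p i => [|k p IH] i /=; first by rewrite eqxx.
move=> il /andP[eik kp]; set l := last k p in il *.
have [ki|ki] := eqVneq k i; first by move: il; rewrite -ki => il; exact: IH.
have [kl|kl] := eqVneq k l; first by rewrite -kl; exact: Se.
exact: (lie_delta_trans Slie il (Se _ _ eik) (IH _ kl kp)).
Qed.

Theorem theorem3 (R : realType) (n : nat) (alpha beta : basis_subset n) :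
  (1 <= n)%N ->
  wcc_strong_ge2 (contr_arc beta) ->
  strongly_connected (union_rel (drift_arc R alpha) (contr_arc beta)) ->
  has_self_loop (union_rel (drift_arc R alpha) (contr_arc beta)) ->
  struct_accessible R alpha beta.
Proof.
move=> _ [wcs wc2] conn [r loop].
(* Strong connectivity of the weak components makes directed reachability symmetric, so [sim] is the
   relation of lying in one component. *)
pose sim := connect (contr_arc beta).
have sim_sym : symmetric sim.
  suff h i j : sim i j -> sim j i by move=> i j; apply/idP/idP; exact: h.
  move=> sij; apply: wcs.
  have usym : symmetric (undirected (contr_arc beta)).
    by move=> x y; rewrite /undirected orbC.
  rewrite (sym_connect_sym usym).
  by apply: connect_sub sij => x y xy; apply: connect1; rewrite /undirected xy.
have sim_trans : transitive sim by exact: connect_trans.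
have sim_partner i : exists2 j : 'I_n, j != i & sim i j.
  by have [j [ji /wcs sij]] := wc2 i; exists j.
(* The weight [3] makes [l_rr + l_pp] differ from every [l_qq + l_q'q'], which
   is what lets the diagonal of [B0] separate the units of [lie_cross]. *)
pose l (p : 'I_n * 'I_n) : R := if p == (r, r) then 3 else 1.
pose B0 : 'M[R]_n := \sum_(p in alpha) l p *: delta_mx p.1 p.2.
pose B (i : 'I_#|beta|) : 'M[R]_n :=
  delta_mx (enum_val i).1 (enum_val i).2.
have l0 p : l p != 0 by rewrite /l; case: ifP => _; apply: lt0r_neq0; lra.
exists #|beta|, B0, B; split.
  (* There is at least one control: [r] has a partner, and the path to it starts with an arc of
     [beta]. *)
  have [j jr /connectP[[|k p] /=]] := sim_partner r.
    by move=> _ jE; rewrite jE eqxx in jr.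
  by move=> /andP[rk _] _; apply/card_gt0P; exists (r, k).
split; first by exists l.
split.
  move=> i; exists (fun p => (p == enum_val i)%:R).
  rewrite (bigD1 (enum_val i)) ?enum_valP //= eqxx scale1r big1 ?addr0 //.
  by move=> p /andP[_ /negbTE ->]; rewrite scale0r.
apply: lie_generated_accessible => S Slie SB0 SB.
have Sbeta i j : contr_arc beta i j -> S (delta_mx i j).
  move=> ij; have ijb : (i, j) \in beta := ij.
  have := SB (enum_rank_in ijb (i, j)).
  by rewrite /B enum_rankK_in.
have Ssim := lie_delta_connect Slie Sbeta.
have B0_conn i j : connect [rel i j | sim i j || (B0 i j != 0)] i j.
  apply: connect_sub (conn i j) => x y; rewrite /union_rel drift_arcE => xy.
  apply: connect1 => /=; rewrite /B0 sum_deltaE; case/orP: xy => [->|xy].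
    by rewrite l0 orbT.
  by rewrite /sim connect1.
(* A drift loop at [r] gives the diagonal of [B0], extracted by [lie_diag], with [3] at [r] and [0]
   or [1] elsewhere; a control loop gives [3 E_rr] directly. *)
have [d [Sd dr d01]] : exists d : 'rV[R]_n, [/\ S (diag_mx d), 3 <= d 0 r &
    forall i, i != r -> 0 <= d 0 i <= 1].
  move: loop; rewrite /union_rel drift_arcE => /orP[ra|rb].
    exists (\row_i B0 i i); split.
    - exact: (lie_diag Slie sim_sym sim_trans sim_partner Ssim SB0).
    - by rewrite mxE sum_deltaE ra /l eqxx.
    move=> i ir; rewrite mxE sum_deltaE /l xpair_eqE (negbTE ir) /=.
    by case: ifP => _; rewrite ?lexx ?ler01.
  exists (3 *: delta_mx 0 r); split.
  - rewrite (_ : diag_mx _ = 3 *: delta_mx r r).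
      by apply: (lieZ Slie); exact: Sbeta.
    apply/matrixP => i j; rewrite !mxE /= [i == j]eq_sym.
    have [->|ij] := eqVneq j i; first by rewrite mulr1n andbb.
    have [ir|_] /= := eqVneq i r; last by rewrite mulr0 mul0rn.
    by rewrite -ir (negbTE ij) mulr0n mulr0.
  - by rewrite !mxE !eqxx mulr1.
  by move=> i /negbTE ir; rewrite !mxE ir /= mulr0 lexx ler01.
exact: (lie_full Slie sim_sym sim_trans sim_partner Ssim SB0 Sd dr d01 B0_conn).
Qed.
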